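(* Let $H$ be a weak Hopf algebra, let $C$ be a left $H$-module coalgebra via $\vartriangleright:H\otimes C\to C$, let $D\subseteq C$ be a subcoalgebra, and let $\pi:C\to C$ be a linear projection with $\pi(C)=D$. Then $D$ is a left partial $H$-module coalgebra via $\cdot:H\otimes D\to D$, $h\otimes d\mapsto\pi(h\vartriangleright d)$, if and only if $\pi$ satisfies, for all $h,k\in H$ and $d\in D$: (i) $(\pi\otimes\pi)\Delta(h\vartriangleright d)=\Delta(\pi(h\vartriangleright d))$; (ii) $\pi(h\vartriangleright\pi(k\vartriangleright d))=\varepsilon(\pi(k_2\vartriangleright d_2))\,\pi(hk_1\vartriangleright d_1)$. In addition, the symmetry condition for this partial action is equivalent to $\pi(h\vartriangleright\pi(k\vartriangleright d))=\varepsilon(\pi(k_1\vartriangleright d_1))\,\pi(hk_2\vartriangleright d_2)$ for all $h,k\in H$ and $d\in D$.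
   Context: Everything is over a fixed field $\Bbbk$; Sweedler notation $\Delta(x)=x_1\otimes x_2$ is used. Weak Hopf algebra: a vector space $H$ that is an algebra and a coalgebra with $\Delta(hk)=\Delta(h)\Delta(k)$; $\varepsilon(hk\ell)=\varepsilon(hk_1)\varepsilon(k_2\ell)=\varepsilon(hk_2)\varepsilon(k_1\ell)$; $(1_H\otimes\Delta(1_H))(\Delta(1_H)\otimes1_H)=(\Delta(1_H)\otimes1_H)(1_H\otimes\Delta(1_H))=\Delta^2(1_H)$; together with a linear antipode $S:H\to H$ with $h_1S(h_2)=\varepsilon_t(h)$, $S(h_1)h_2=\varepsilon_s(h)$, $S(h_1)h_2S(h_3)=S(h)$, where $\varepsilon_t(h)=\varepsilon(1_1h)1_2$, $\varepsilon_s(h)=1_1\varepsilon(h1_2)$ and $1_1\otimes1_2=\Delta(1_H)$. Left $H$-module coalgebra: a coalgebra $C$ with a linear map $\vartriangleright:H\otimes C\to C$ such that for all $h,k\in H$, $c\in C$: $1_H\vartriangleright c=c$; $\Delta(h\vartriangleright c)=h_1\vartriangleright c_1\otimes h_2\vartriangleright c_2$; $h\vartriangleright(k\vartriangleright c)=hk\vartriangleright c$; $\varepsilon(h\vartriangleright c)=\varepsilon(\varepsilon_s(h)\vartriangleright c)$. Left partial $H$-module coalgebra: a coalgebra $C$ with a linear map $\cdot:H\otimes C\to C$ such that for all $h,k\in H$, $c\in C$: $1_H\cdot c=c$; $\Delta(h\cdot c)=h_1\cdot c_1\otimes h_2\cdot c_2$; $h\cdot(k\cdot c)=(hk_1\cdot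 c_1)\,\varepsilon(k_2\cdot c_2)$. The symmetry condition is: $h\cdot(k\cdot c)=\varepsilon(k_1\cdot c_1)\,(hk_2\cdot c_2)$ for all $h,k,c$. *)

(* Defs.v *)
From HB Require Import structures.
From mathcomp Require Import all_boot all_algebra.
From mathcomp Require Import boolp classical_sets.

Set Implicit Arguments.
Unset Strict Implicit.
Unset Printing Implicit Defensive.

Import GRing.Theory.
Local Open Scope ring_scope.
Local Open Scope quotient_scope.

Section TensorProduct.
Variables (K : fieldType) (U V : lmodType K).

Definition bilin (W : lmodType K) (b : U -> V -> W) :=
  bilinear_for *:%R *:%R b.

Definition formal_eval (W : nmodType) (b : U -> V -> W) (s : seq (U * V)) : W :=
  \sum_(p <- s) b p.1 p.2.

(* A sequence of pairs stands for the formal sum of the corresponding pure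
   tensors. Two formal sums are identified when every bilinear map agrees on
   them, that is, when their difference lies in the subspace generated by the
   bilinearity relations. [tprod_bilin], [tfold_linear], [tfold_tprod] and
   [tfold_unique] are the universal property. *)
Definition tensor_eq : rel (seq (U * V)) := fun s t =>
  `[< forall (W : lmodType K) (b : U -> V -> W), bilin b ->
        formal_eval b s = formal_eval b t >].

Lemma tensor_eq_refl : reflexive tensor_eq.
Proof. by move=> s; apply/asboolP. Qed.

Lemma tensor_eq_sym : symmetric tensor_eq.
Proof. by move=> s t; apply/asboolP/asboolP => h W b /h ->. Qed.

Lemma tensor_eq_trans : transitive tensor_eq.
Proof.
move=> t s r /asboolP h1 /asboolP h2; apply/asboolP => W b hb.
by rewrite h1 ?h2.
Qed.

Canonical tensor_equiv :=
  EquivRel tensor_eq tensor_eq_refl tensor_eq_sym tensor_eq_trans.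

Definition tensor := {eq_quot tensor_eq}.
HB.instance Definition _ := Choice.on tensor.
HB.instance Definition _ := EqQuotient.on tensor.

Lemma tensor_piP (s t : seq (U * V)) :
  (forall (W : lmodType K) (b : U -> V -> W), bilin b ->
     formal_eval b s = formal_eval b t) <-> \pi_tensor s = \pi_tensor t.
Proof.
split=> [h|/eqmodP/asboolP//].
by apply/eqmodP/asboolP.
Qed.

Lemma formal_eval_repr (W : lmodType K) (b : U -> V -> W) s : bilin b ->
  formal_eval b (repr (\pi_tensor s)) = formal_eval b s.
Proof. by move=> hb; have /tensor_piP := reprK (\pi_tensor s); apply. Qed.

Definition tensor_zero : tensor := \pi_tensor [::].
Definition tensor_add (x y : tensor) : tensor := \pi_tensor (repr x ++ repr y).
Definition tensor_scale (a : K) (x : tensor) : tensor :=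
  \pi_tensor [seq (a *: p.1, p.2) | p <- repr x].
Definition tensor_opp (x : tensor) : tensor := tensor_scale (-1) x.

(* [tfold b t] is the value at t of the linear map induced by b; it is
   meaningful when b is bilinear. *)
Definition tfold (W : nmodType) (b : U -> V -> W) (t : tensor) : W :=
  formal_eval b (repr t).

Definition tprod (u : U) (v : V) : tensor := \pi_tensor [:: (u, v)].

Lemma tensorP (x y : tensor) :
  (forall (W : lmodType K) (b : U -> V -> W), bilin b ->
    tfold b x = tfold b y) -> x = y.
Proof. by move=> h; rewrite -[x]reprK -[y]reprK; apply/tensor_piP. Qed.

Lemma formal_eval_scale (W : lmodType K) (b : U -> V -> W) a s : bilin b ->
  formal_eval b [seq (a *: p.1, p.2) | p <- s] = a *: formal_eval b s.
Proof.
move=> [b1 _]; rewrite /formal_eval big_map scaler_sumr; apply: eq_bigr => p _.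
have := b1 p.2 a p.1 0; rewrite addr0 /= => ->.
have := b1 p.2 (-1) 0 0; rewrite scaler0 addr0 /= => {1}->.
by rewrite scaleN1r addNr addr0.
Qed.

Let tfold0 (W : lmodType K) (b : U -> V -> W) : bilin b ->
  tfold b tensor_zero = 0.
Proof.
by move=> hb; rewrite /tfold formal_eval_repr // /formal_eval big_nil.
Qed.

Let tfoldD (W : lmodType K) (b : U -> V -> W) x y : bilin b ->
  tfold b (tensor_add x y) = tfold b x + tfold b y.
Proof.
by move=> hb; rewrite /tfold formal_eval_repr // /formal_eval big_cat.
Qed.

Let tfoldZ (W : lmodType K) (b : U -> V -> W) a x : bilin b ->
  tfold b (tensor_scale a x) = a *: tfold b x.
Proof.
by move=> hb; rewrite /tfold formal_eval_repr // formal_eval_scale.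
Qed.

Let tfoldN (W : lmodType K) (b : U -> V -> W) x : bilin b ->
  tfold b (tensor_opp x) = - tfold b x.
Proof. by move=> hb; rewrite tfoldZ // scaleN1r. Qed.

Let tensor_addA : associative tensor_add.
Proof.
by move=> x y z; apply: tensorP => W b hb; rewrite !tfoldD // addrA.
Qed.
Let tensor_addC : commutative tensor_add.
Proof. by move=> x y; apply: tensorP => W b hb; rewrite !tfoldD // addrC. Qed.
Let tensor_add0 : left_id tensor_zero tensor_add.
Proof.
by move=> x; apply: tensorP => W b hb; rewrite tfoldD // tfold0 // add0r.
Qed.
Let tensor_addN : left_inverse tensor_zero tensor_opp tensor_add.
Proof.
move=> x; apply: tensorP => W b hb.
by rewrite tfoldD // tfold0 // tfoldN // addNr.
Qed.

HB.instance Definition _ := GRing.isZmodule.Build tensor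
  tensor_addA tensor_addC tensor_add0 tensor_addN.

Let tensor_scaleA a b x :
  tensor_scale a (tensor_scale b x) = tensor_scale (a * b) x.
Proof.
by apply: tensorP => W f hf; rewrite !tfoldZ // scalerA.
Qed.
Let tensor_scale1 : left_id 1 tensor_scale.
Proof. by move=> x; apply: tensorP => W f hf; rewrite tfoldZ // scale1r. Qed.
Let tensor_scaleDr : right_distributive tensor_scale +%R.
Proof.
move=> a x y; apply: tensorP => W f hf.
by rewrite tfoldZ // !tfoldD // !tfoldZ // scalerDr.
Qed.
Let tensor_scaleDl x : {morph tensor_scale^~ x : a b / a + b}.
Proof.
move=> a b; apply: tensorP => W f hf.
by rewrite tfoldD // !tfoldZ // scalerDl.
Qed.

HB.instance Definition _ := GRing.Zmodule_isLmodule.Build K tensor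
  tensor_scaleA tensor_scale1 tensor_scaleDr tensor_scaleDl.

Lemma tfold_linear (W : lmodType K) (b : U -> V -> W) :
  bilin b -> linear (tfold b).
Proof. by move=> hb a x y; rewrite [LHS]tfoldD // tfoldZ. Qed.

Lemma tfold_tprod (W : lmodType K) (b : U -> V -> W) u v :
  bilin b -> tfold b (tprod u v) = b u v.
Proof.
by move=> hb; rewrite /tfold formal_eval_repr // /formal_eval big_seq1.
Qed.

Lemma tprod_bilin : bilin tprod.
Proof.
split=> [v a x y|u a x y]; apply: tensorP => W b hb;
  rewrite [RHS]tfold_linear // !tfold_tprod //; [exact: hb.1|exact: hb.2].
Qed.

Lemma tensor_sum (t : tensor) : t = \sum_(p <- repr t) tprod p.1 p.2.
Proof.
apply: tensorP => W b hb.
have hl := tfold_linear hb.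
pose f := GRing.isLinear.Build K tensor W *:%R (tfold b) hl.
pose F : {linear tensor -> W} := HB.pack (tfold b) f.
rewrite -[RHS]/(F _) linear_sum /= /tfold /formal_eval.
by apply: eq_bigr => p _; rewrite -[RHS]/(tfold b _) tfold_tprod.
Qed.

Lemma tensor_ind (P : tensor -> Prop) : P 0 ->
  (forall u v t, P t -> P (tprod u v + t)) -> forall t, P t.
Proof.
move=> P0 PD t; rewrite (tensor_sum t).
by elim: (repr t) => [|p s IH]; rewrite ?big_nil ?big_cons //; apply: PD.
Qed.

Lemma tensor_linear_ext (W : lmodType K) (f g : tensor -> W) :
  linear f -> linear g -> (forall u v, f (tprod u v) = g (tprod u v)) ->
  f =1 g.
Proof.
move=> hf hg h.
have h0 (k : tensor -> W) : linear k -> k 0 = 0.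
  by move=> /(_ (-1) 0 0); rewrite scaler0 addr0 scaleN1r addNr.
apply: tensor_ind; first by rewrite !h0.
by move=> u v t IH; rewrite -[tprod u v]scale1r hf hg h IH.
Qed.

Lemma tfold_unique (W : lmodType K) (b : U -> V -> W) (f : tensor -> W) :
  bilin b -> linear f -> (forall u v, f (tprod u v) = b u v) -> f =1 tfold b.
Proof.
move=> hb hf h; apply: tensor_linear_ext => //; first exact: tfold_linear.
by move=> u v; rewrite h tfold_tprod.
Qed.

End TensorProduct.

Arguments tensor {K} (U V)%_type_scope.
Arguments tprod {K U V}.

Notation "U ⊗ V" := (tensor U V) (at level 40, left associativity) : type_scope.
Notation "u ⊗ v" := (tprod u v) (at level 40, left associativity) : ring_scope.
Notation "\sw_ ( x , y <- t ) E" := (tfold (fun x y => E) t)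
  (at level 41, x name, y name, t at level 39, E at level 41,
   format "'[' \sw_ ( x ,  y  <-  t ) '/  '  E ']'") : ring_scope.

Lemma comp_is_linear (K : fieldType) (U V W : lmodType K)
  (f : V -> W) (g : U -> V) : linear f -> linear g -> linear (f \o g).
Proof. by move=> hf hg k x y; rewrite /= hg hf. Qed.

Lemma bilin_comp (K : fieldType) (U V U' V' W : lmodType K)
    (f : {linear U -> U'}) (g : {linear V -> V'}) (b : U' -> V' -> W) :
  bilin b -> bilin (fun u v => b (f u) (g v)).
Proof.
move=> [b1 b2]; split=> [v a x y|u a x y] /=; rewrite linearP.
  exact: b1.
exact: b2.
Qed.

Section TensorMap.
Variables (K : fieldType) (U V U' V' : lmodType K).

Definition tmap (f : U -> U') (g : V -> V') (t : U ⊗ V) : U' ⊗ V' :=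
  \sw_(u, v <- t) (f u ⊗ g v).

Variables (f : {linear U -> U'}) (g : {linear V -> V'}).

Lemma tmap_bilin : bilin (fun u v => f u ⊗ g v).
Proof. exact/bilin_comp/tprod_bilin. Qed.

Lemma tmap_linear : linear (tmap f g).
Proof. exact/tfold_linear/tmap_bilin. Qed.

HB.instance Definition _ :=
  GRing.isLinear.Build K (U ⊗ V)%type (U' ⊗ V')%type *:%R (tmap f g) tmap_linear.

Lemma tmap_tprod u v : tmap f g (u ⊗ v) = f u ⊗ g v.
Proof. exact/tfold_tprod/tmap_bilin. Qed.

End TensorMap.

Lemma tmap_comp (K : fieldType) (U V U' V' U'' V'' : lmodType K)
    (f : {linear U -> U'}) (g : {linear V -> V'})
    (f' : {linear U' -> U''}) (g' : {linear V' -> V''}) t :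
  tmap f' g' (tmap f g t) = tmap (f' \o f) (g' \o g) t.
Proof.
apply: (@tensor_linear_ext _ _ _ _
  (tmap f' g' \o tmap f g) (tmap (f' \o f) (g' \o g))).
- exact: linearP.
- exact: linearP.
- by move=> u v; rewrite /= !tmap_tprod.
Qed.

Section TensorAssoc.
Variables (K : fieldType) (U V W : lmodType K).

Definition tassoc (t : (U ⊗ V) ⊗ W) : U ⊗ (V ⊗ W) :=
  \sw_(x, w <- t) \sw_(u, v <- x) (u ⊗ (v ⊗ w)).

Lemma tassoc_inner_bilin (w : W) : bilin (fun (u : U) (v : V) => u ⊗ (v ⊗ w)).
Proof.
split=> [v a x y|u a x y] /=; first exact: (tprod_bilin _ _).1.
by rewrite (tprod_bilin _ _).1 (tprod_bilin _ _).2.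
Qed.

Lemma tassoc_outer_bilin :
  bilin (fun (x : U ⊗ V) (w : W) => \sw_(u, v <- x) (u ⊗ (v ⊗ w))).
Proof.
split=> [w a x y|x a w w'] /=; first exact/tfold_linear/tassoc_inner_bilin.
move: x; apply: tensor_linear_ext.
- exact/tfold_linear/tassoc_inner_bilin.
- move=> c x y; rewrite !(tfold_linear (tassoc_inner_bilin _)).
  rewrite !scalerDr !scalerA [a * c]mulrC -!addrA; congr (_ + _).
  by rewrite addrCA.
- move=> u v; rewrite !tfold_tprod; try exact: tassoc_inner_bilin.
  by rewrite !(tprod_bilin _ _).2.
Qed.

Lemma tassoc_linear : linear tassoc.
Proof. exact/tfold_linear/tassoc_outer_bilin. Qed.

HB.instance Definition _ :=
  GRing.isLinear.Build K ((U ⊗ V) ⊗ W)%type (U ⊗ (V ⊗ W))%type *:%R tassoc tassoc_linear.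

Lemma tassoc_tprod (u : U) (v : V) (w : W) : tassoc ((u ⊗ v) ⊗ w) = u ⊗ (v ⊗ w).
Proof.
rewrite /tassoc tfold_tprod; last exact: tassoc_outer_bilin.
by rewrite tfold_tprod //; apply: tassoc_inner_bilin.
Qed.

End TensorAssoc.

Lemma tassoc_tmap (K : fieldType) (U V W U' V' W' : lmodType K)
    (f : {linear U -> U'}) (g : {linear V -> V'}) (h : {linear W -> W'}) t :
  tassoc (tmap (tmap f g) h t) = tmap f (tmap g h) (tassoc t).
Proof.
move: t; apply: (@tensor_linear_ext _ _ _ _
  (@tassoc _ _ _ _ \o tmap (tmap f g) h) (tmap f (tmap g h) \o @tassoc _ _ _ _)).
- exact: linearP.
- exact: linearP.
- move=> x w; rewrite /= tmap_tprod.
  move: x; apply: (@tensor_linear_ext _ _ _ _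
    (@tassoc _ _ _ _ \o (tprod^~ (h w) \o tmap f g))
    (tmap f (tmap g h) \o (@tassoc _ _ _ _ \o tprod^~ w))).
  + apply: comp_is_linear; first exact: linearP.
    by apply: comp_is_linear; [exact: (tprod_bilin _ _).1|exact: linearP].
  + apply: comp_is_linear; first exact: linearP.
    by apply: comp_is_linear; [exact: linearP|exact: (tprod_bilin _ _).1].
  + by move=> u v; rewrite /= tmap_tprod !tassoc_tprod !tmap_tprod /= tmap_tprod.
Qed.

(* Unital associative algebras, the zero algebra included. The library's
   algType is built on non-trivial rings and excludes it. *)
HB.mixin Record isAssocAlgebra (K : fieldType) A of GRing.Lmodule K A := {
  amul : A -> A -> A;
  aone : A;
  amul_bilin : bilin amul;
  amulA : associative amul;
  amul1l : left_id aone amul;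
  amul1r : right_id aone amul
}.

#[short(type="assocAlgType")]
HB.structure Definition AssocAlgebra (K : fieldType) :=
  {A of isAssocAlgebra K A & GRing.Lmodule K A}.

Arguments aone {K s}.
Notation "x ∙ y" := (amul x y) (at level 38, left associativity) : ring_scope.

Section TensorAlgebra.
Variables (K : fieldType) (A B : assocAlgType K).

Definition tensor_mul (s t : A ⊗ B) : A ⊗ B :=
  \sw_(a, b <- s) \sw_(c, d <- t) ((a ∙ c) ⊗ (b ∙ d)).

Let mul_inner (a : A) (b : B) : bilin (fun c d => (a ∙ c) ⊗ (b ∙ d)).
Proof.
split=> [d k x y|c k x y]; rewrite (amul_bilin.2 _ k x y);
  [exact: (tprod_bilin _ _).1|exact: (tprod_bilin _ _).2].
Qed.

Let mul_outer t :
  bilin (fun (a : A) (b : B) => \sw_(c, d <- t) ((a ∙ c) ⊗ (b ∙ d))).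
Proof.
have aux (W : lmodType K) (k : K) (x y x' y' : W) l :
  k *: (l *: x + y) + (l *: x' + y') = l *: (k *: x + x') + (k *: y + y').
  by rewrite !scalerDr !scalerA [k * l]mulrC addrACA.
split=> [b k x y|a k x y]; move: t; apply: tensor_linear_ext.
- exact/tfold_linear/mul_inner.
- by move=> l s t; rewrite !(tfold_linear (mul_inner _ _)) aux.
- move=> c d; rewrite !tfold_tprod; try exact: mul_inner.
  by rewrite (amul_bilin.1 c k x y) (tprod_bilin _ _).1.
- exact/tfold_linear/mul_inner.
- by move=> l s t; rewrite !(tfold_linear (mul_inner _ _)) aux.
- move=> c d; rewrite !tfold_tprod; try exact: mul_inner.
  by rewrite (amul_bilin.1 d k x y) (tprod_bilin _ _).2.
Qed.

Let tensor_mul_linearl t : linear (tensor_mul^~ t).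
Proof. exact/tfold_linear/mul_outer. Qed.

Let tensor_mul_tprod a b c d :
  tensor_mul (a ⊗ b) (c ⊗ d) = (a ∙ c) ⊗ (b ∙ d).
Proof.
rewrite /tensor_mul tfold_tprod; last exact: mul_outer.
by rewrite tfold_tprod.
Qed.

Let tensor_mul_linearr s : linear (tensor_mul s).
Proof.
move=> k x y; move: s; apply: tensor_linear_ext.
- exact: tensor_mul_linearl.
- move=> l s t; rewrite !(tensor_mul_linearl _ l).
  by rewrite !scalerDr !scalerA [k * l]mulrC addrACA.
- move=> a b; rewrite /tensor_mul !tfold_tprod; try exact: mul_outer.
  exact/tfold_linear/mul_inner.
Qed.

Let tensor_mulA : associative tensor_mul.
Proof.
move=> x y z; move: x; apply: (@tensor_linear_ext _ _ _ _
  (tensor_mul^~ (tensor_mul y z)) (tensor_mul^~ z \o tensor_mul^~ y)).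
- exact: tensor_mul_linearl.
- by apply: comp_is_linear; apply: tensor_mul_linearl.
move=> a b /=; move: y; apply: (@tensor_linear_ext _ _ _ _
  (tensor_mul (a ⊗ b) \o tensor_mul^~ z) (tensor_mul^~ z \o tensor_mul (a ⊗ b))).
- by apply: comp_is_linear.
- by apply: comp_is_linear.
move=> c d /=; move: z; apply: (@tensor_linear_ext _ _ _ _
  (tensor_mul (a ⊗ b) \o tensor_mul (c ⊗ d)) (tensor_mul _)).
- by apply: comp_is_linear; apply: tensor_mul_linearr.
- exact: tensor_mul_linearr.
by move=> e f; rewrite /= !tensor_mul_tprod !amulA.
Qed.

Let tensor_mul1l : left_id (aone ⊗ aone) tensor_mul.
Proof.
apply: tensor_linear_ext; first exact: tensor_mul_linearr; first by [].
by move=> a b; rewrite tensor_mul_tprod !amul1l.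
Qed.

Let tensor_mul1r : right_id (aone ⊗ aone) tensor_mul.
Proof.
apply: (@tensor_linear_ext _ _ _ _ (tensor_mul^~ (aone ⊗ aone))) => //.
by move=> a b; rewrite tensor_mul_tprod !amul1r.
Qed.

HB.instance Definition _ := isAssocAlgebra.Build K (A ⊗ B)%type
  (tensor_mul_linearl, tensor_mul_linearr)
  tensor_mulA tensor_mul1l tensor_mul1r.

Lemma tprodM (a c : A) (b d : B) : (a ⊗ b) ∙ (c ⊗ d) = (a ∙ c) ⊗ (b ∙ d).
Proof. exact: tensor_mul_tprod. Qed.

End TensorAlgebra.

HB.mixin Record isCoalgebra (K : fieldType) C of GRing.Lmodule K C := {
  comul : {linear C -> (C ⊗ C)%type};
  counit : {scalar C};
  comulA : forall c : C,
    tassoc (tmap comul idfun (comul c)) = tmap idfun comul (comul c);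
  counitl : forall c : C, \sw_(x, y <- comul c) (counit x *: y) = c;
  counitr : forall c : C, \sw_(x, y <- comul c) (counit y *: x) = c
}.

#[short(type="coalgType")]
HB.structure Definition Coalgebra (K : fieldType) :=
  {C of isCoalgebra K C & GRing.Lmodule K C}.

#[short(type="algCoalgType")]
HB.structure Definition AlgCoalgebra (K : fieldType) :=
  {H of AssocAlgebra K H & Coalgebra K H}.

Section CounitalMaps.
Variables (K : fieldType) (H : algCoalgType K).

Definition eps_t (h : H) : H :=
  \sw_(x, y <- comul (aone : H)) (counit (x ∙ h) *: y).

Definition eps_s (h : H) : H :=
  \sw_(x, y <- comul (aone : H)) (counit (h ∙ y) *: x).

End CounitalMaps.

HB.mixin Record isWeakBialgebra (K : fieldType) H of AlgCoalgebra K H := {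
  comulM : forall h k : H, comul (h ∙ k) = comul h ∙ comul k;
  counitM12 : forall h k l : H,
    counit (h ∙ k ∙ l) =
    \sw_(k1, k2 <- comul k) (counit (h ∙ k1) * counit (k2 ∙ l));
  counitM21 : forall h k l : H,
    counit (h ∙ k ∙ l) =
    \sw_(k1, k2 <- comul k) (counit (h ∙ k2) * counit (k1 ∙ l));
  comul1_12 :
    (aone ⊗ comul (aone : H)) ∙ tassoc (comul (aone : H) ⊗ aone) =
    tmap idfun comul (comul (aone : H));
  comul1_21 :
    tassoc (comul (aone : H) ⊗ aone) ∙ (aone ⊗ comul (aone : H)) =
    tmap idfun comul (comul (aone : H))
}.

#[short(type="weakBialgType")]
HB.structure Definition WeakBialgebra (K : fieldType) :=
  {H of isWeakBialgebra K H & AlgCoalgebra K H}.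

HB.mixin Record isWeakHopf (K : fieldType) H of WeakBialgebra K H := {
  antipode : {linear H -> H};
  antipode_t : forall h : H,
    \sw_(h1, h2 <- comul h) (h1 ∙ antipode h2) = eps_t h;
  antipode_s : forall h : H,
    \sw_(h1, h2 <- comul h) (antipode h1 ∙ h2) = eps_s h;
  antipode_id : forall h : H,
    \sw_(h1, x <- comul h) \sw_(h2, h3 <- comul x)
      (antipode h1 ∙ h2 ∙ antipode h3) = antipode h
}.

#[short(type="weakHopfType")]
HB.structure Definition WeakHopf (K : fieldType) :=
  {H of isWeakHopf K H & WeakBialgebra K H}.

Section Actions.
Variables (K : fieldType) (H : weakHopfType K) (C : coalgType K).
Variable act : {linear (H ⊗ C)%type -> C}.

Local Notation "h ▷ c" := (act (h ⊗ c)) (at level 35, right associativity).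

Record module_coalgebra : Prop := ModuleCoalgebra {
  mc_unit : forall c, aone ▷ c = c;
  mc_comul : forall h c,
    comul (h ▷ c) =
    \sw_(h1, h2 <- comul h) \sw_(c1, c2 <- comul c) ((h1 ▷ c1) ⊗ (h2 ▷ c2));
  mc_act : forall h k c, h ▷ k ▷ c = (h ∙ k) ▷ c;
  mc_counit : forall h c, counit (h ▷ c) = counit (eps_s h ▷ c)
}.

Record partial_module_coalgebra : Prop := PartialModuleCoalgebra {
  pmc_unit : forall c, aone ▷ c = c;
  pmc_comul : forall h c,
    comul (h ▷ c) =
    \sw_(h1, h2 <- comul h) \sw_(c1, c2 <- comul c) ((h1 ▷ c1) ⊗ (h2 ▷ c2));
  pmc_act : forall h k c,
    h ▷ k ▷ c =
    \sw_(k1, k2 <- comul k) \sw_(c1, c2 <- comul c)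
      (counit (k2 ▷ c2) *: ((h ∙ k1) ▷ c1))
}.

Definition symmetric_action : Prop := forall h k c,
  h ▷ k ▷ c =
  \sw_(k1, k2 <- comul k) \sw_(c1, c2 <- comul c)
    (counit (k1 ▷ c1) *: ((h ∙ k2) ▷ c2)).

End Actions.

Section Subspace.
Variables (K : fieldType) (V : lmodType K) (D : submodClosed V).

Definition subspace := {x : V | x \in D}.
HB.instance Definition _ := Choice.on subspace.
HB.instance Definition _ := [isSub of subspace for sval].
HB.instance Definition _ := [SubChoice_isSubLmodule of subspace by <:].

Definition incl : {linear subspace -> V} := val.

Definition corestr (U : lmodType K) (f : U -> V) (fD : forall u, f u \in D)
  : U -> subspace := fun u => Sub (f u) (fD u).

Lemma val_corestr (U : lmodType K) (f : U -> V) fD (u : U) :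
  incl (@corestr U f fD u) = f u.
Proof. exact: SubK. Qed.

Lemma corestr_linear (U : lmodType K) (f : {linear U -> V}) fD :
  linear (@corestr U f fD).
Proof.
move=> a x y; apply: val_inj.
by rewrite -[LHS]/(incl _) -[RHS]/(incl _) linearP !val_corestr linearP.
Qed.

HB.instance Definition _ (U : lmodType K) (f : {linear U -> V}) fD :=
  GRing.isLinear.Build K U subspace *:%R (@corestr U f fD)
    (@corestr_linear U f fD).

End Subspace.

Lemma tfold_tmap (K : fieldType) (U V U' V' W : lmodType K)
    (f : {linear U -> U'}) (g : {linear V -> V'}) (b : U' -> V' -> W) t :
  bilin b -> tfold b (tmap f g t) = \sw_(u, v <- t) b (f u) (g v).
Proof.
move=> hb; have hb' := bilin_comp f g hb.
move: t; apply: (@tensor_linear_ext _ _ _ _ (tfold b \o tmap f g)).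
- by apply: comp_is_linear; [exact: tfold_linear|exact: linearP].
- exact: tfold_linear.
- by move=> u v; rewrite /= tmap_tprod !tfold_tprod.
Qed.

Lemma linear_tfold (K : fieldType) (U V W W' : lmodType K)
    (f : {linear W -> W'}) (b : U -> V -> W) t :
  f (tfold b t) = \sw_(u, v <- t) f (b u v).
Proof. by rewrite /tfold /formal_eval linear_sum. Qed.

Section Retraction.
Variables (K : fieldType) (V : lmodType K) (D : submodClosed V).

Lemma subspace_complement : exists E : set V,
  [/\ E 0, forall a x y, E x -> E y -> E (a *: x + y),
      forall x, E x -> x \in D -> x = 0 &
      forall v, exists2 d, d \in D & E (v - d)].
Proof.
pose P (E : set V) := (forall a x y, E x -> E y -> E (a *: x + y)) /\
  (forall x, E x -> x \in D -> x = 0).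
have [|E [[EL ED] Emax]] := @Zorn_bigcup V P.
  move=> F FP tot; split=> [a x y [X FX Xx] [Y FY Yy]|x [X FX Xx]]; last first.
    exact: (FP X FX).2.
  have [XY|YX] := tot _ _ FX FY.
    by exists Y => //; apply: (FP Y FY).1 => //; apply: XY.
  by exists X => //; apply: (FP X FX).1 => //; apply: YX.
have maxE E' : P E' -> (E `<=` E')%classic -> (E' `<=` E)%classic.
  move=> PE' sub; apply: contrapT => nsub; by apply: (Emax E') => //; split.
have E0 : E 0.
  have [[x Ex]|nE] := pselect (exists x, E x).
    by have := EL (-1) x x Ex Ex; rewrite scaleN1r addNr.
  apply: (maxE [set x | x = 0]%classic) => //.
    by split=> [a x y -> ->|x -> //]; rewrite /= scaler0 addr0.
  by move=> x Ex; case: nE; exists x.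
exists E; split=> // v; apply: contrapT => nv.
have vE' : E v.
  apply: (maxE [set x | exists a e, E e /\ x = a *: v + e]%classic).
  - split=> [a x y [b [e [Ee ->]]] [c [e' [Ee' ->]]]|x [a [e [Ee ->]]] hD].
      exists (a * b + c), (a *: e + e'); split; first exact: EL.
      by rewrite scalerDr scalerDl scalerA addrACA.
    have [a0|a0] := eqVneq a 0.
      by move: hD; rewrite a0 scale0r add0r; exact: ED.
    case: nv; exists (a^-1 *: (a *: v + e)); first by rewrite rpredZ.
    rewrite scalerDr scalerA mulVf // scale1r opprD addrA subrr add0r.
    by rewrite -scaleNr -[_ *: e]addr0; exact: EL.
  - by move=> e Ee; exists 0, e; rewrite scale0r add0r.
  - by exists 1, 0; rewrite scale1r addr0.
by case: nv; exists 0; rewrite ?subr0 ?rpred0.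
Qed.

Lemma subspace_retraction :
  exists r : {linear V -> subspace D}, cancel (incl D) r.
Proof.
have [E [E0 EL ED EV]] := subspace_complement.
have uniq d d' v : d \in D -> d' \in D -> E (v - d) -> E (v - d') -> d = d'.
  move=> hd hd' e e'; apply/subr0_eq; apply: (ED (d - d')); last first.
    by rewrite -scaleN1r rpredD ?rpredZ.
  by have := EL (-1) _ _ e e'; rewrite scaleN1r opprB addrA subrK.
have /choice[r hr] : forall v, exists d : subspace D, E (v - incl D d).
  by move=> v; have [d hd e] := EV v; exists (Sub d hd).
have rL : linear r.
  move=> a x y; apply: val_inj.
  apply: (uniq _ _ (a *: x + y)); [exact: valP|exact: valP|exact: hr|].
  have -> : val (a *: r x + r y) = a *: incl D (r x) + incl D (r y).
    by rewrite -[LHS]/(incl D _) linearP.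
  rewrite opprD addrACA -scalerBr.
  by apply: EL; apply: hr.
pose rl : {linear V -> subspace D} :=
  HB.pack r (GRing.isLinear.Build K V (subspace D) *:%R r rL).
exists rl => d.
apply: val_inj => /=; apply: (uniq _ _ (incl D d)); [exact: valP|exact: valP| |].
  exact: hr.
by rewrite subrr.
Qed.

End Retraction.

Section Subcoalgebra.
Variables (K : fieldType) (C : coalgType K) (D : submodClosed C).

(* The image of [tmap incl incl] is D ⊗ D seen inside C ⊗ C. *)
Definition subcoalgebra : Prop := forall d, d \in D ->
  exists t : subspace D ⊗ subspace D, comul d = tmap (incl D) (incl D) t.

Lemma tmap_incl_inj : injective (tmap (incl D) (incl D)).
Proof.
have [r rK] := subspace_retraction D.
apply: (@can_inj _ _ _ (tmap r r)) => t; rewrite tmap_comp.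
move: t; apply: (@tensor_linear_ext _ _ _ _ (tmap (r \o incl D) (r \o incl D)) id).
- exact: linearP.
- by [].
- by move=> u v; rewrite tmap_tprod /= !rK.
Qed.

Lemma tmap3_incl_inj :
  injective (tmap (incl D) (tmap (incl D) (incl D))).
Proof.
have [r rK] := subspace_retraction D.
apply: (@can_inj _ _ _ (tmap r (tmap r r))) => t; rewrite tmap_comp.
have tK x : tmap r r (tmap (incl D) (incl D) x) = x.
  rewrite tmap_comp; move: x; apply: (@tensor_linear_ext _ _ _ _
    (tmap (r \o incl D) (r \o incl D)) id).
  - exact: linearP.
  - by [].
  - by move=> u v; rewrite tmap_tprod /= !rK.
move: t; apply: (@tensor_linear_ext _ _ _ _
  (tmap (r \o incl D) (tmap r r \o tmap (incl D) (incl D))) id).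
- exact: linearP.
- by [].
- by move=> u v; rewrite tmap_tprod /= rK tK.
Qed.

Hypothesis hD : subcoalgebra.

Definition subcoalg_comul (d : subspace D) : subspace D ⊗ subspace D :=
  projT1 (cid (hD (valP d))).

Lemma subcoalg_comulE d :
  tmap (incl D) (incl D) (subcoalg_comul d) = comul (incl D d).
Proof. by rewrite /subcoalg_comul; case: cid. Qed.

Lemma subcoalg_comul_linear : linear subcoalg_comul.
Proof.
by move=> a x y; apply: tmap_incl_inj; rewrite [RHS]linearP /= !subcoalg_comulE !linearP.
Qed.

End Subcoalgebra.

(* A subcoalgebra as a coalgebra in its own right: its comultiplication is the
   unique corestriction of that of C to D ⊗ D. *)
Definition subcoalg (K : fieldType) (C : coalgType K) (D : submodClosed C)
  (hD : subcoalgebra D) := subspace D.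

Section SubcoalgStructure.
Variables (K : fieldType) (C : coalgType K) (D : submodClosed C).
Variable hD : subcoalgebra D.

HB.instance Definition _ := GRing.SubLmodule.on (subcoalg hD).

HB.instance Definition _ :=
  GRing.isLinear.Build K (subspace D) (subspace D ⊗ subspace D)%type *:%R
    (subcoalg_comul hD) (subcoalg_comul_linear hD).

Let cm : {linear subspace D -> (subspace D ⊗ subspace D)%type} :=
  subcoalg_comul hD.
Let ct : {scalar subspace D} := counit \o incl D.
Let ii := tmap (incl D) (incl D).

Let comul_incl : ii \o cm = comul \o incl D.
Proof. by apply/funext => d; exact: subcoalg_comulE. Qed.

Let cmA d : tassoc (tmap cm idfun (cm d)) = tmap idfun cm (cm d).
Proof.
apply: tmap3_incl_inj; rewrite -tassoc_tmap !tmap_comp comul_incl.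
transitivity (tassoc (tmap comul idfun (ii (cm d)))).
  by rewrite /ii tmap_comp.
transitivity (tmap idfun comul (ii (cm d))); last first.
  by rewrite /ii tmap_comp -comul_incl.
by rewrite -[ii (cm d)]/((ii \o cm) d) comul_incl; exact: comulA.
Qed.

Let cml d : \sw_(x, y <- cm d) (ct x *: y) = d.
Proof.
apply: val_inj; rewrite -[LHS]/(incl D _) linear_tfold.
rewrite -[RHS](counitl (incl D d)) -subcoalg_comulE tfold_tmap.
  by congr tfold; apply/funext => x; apply/funext => y; rewrite linearZ.
by split=> [v a x y|u a x y] /=; rewrite linearP ?scalerDl ?scalerA //
  scalerDr !scalerA mulrC.
Qed.

Let cmr d : \sw_(x, y <- cm d) (ct y *: x) = d.
Proof.
apply: val_inj; rewrite -[LHS]/(incl D _) linear_tfold.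
rewrite -[RHS](counitr (incl D d)) -subcoalg_comulE tfold_tmap.
  by congr tfold; apply/funext => x; apply/funext => y; rewrite linearZ.
by split=> [v a x y|u a x y] /=; rewrite linearP ?scalerDl ?scalerA //
  scalerDr !scalerA mulrC.
Qed.

HB.instance Definition _ := isCoalgebra.Build K (subcoalg hD) cmA cml cmr.

End SubcoalgStructure.

Section SubcoalgTheory.
Variables (K : fieldType) (C : coalgType K) (D : submodClosed C).
Variable hD : subcoalgebra D.

Definition subcoalg_incl : {linear subcoalg hD -> C} := incl D.

Lemma subcoalg_inclP d : subcoalg_incl d \in D.
Proof. exact: (valP (d : subspace D)). Qed.

Lemma subcoalg_incl_inj : injective subcoalg_incl.
Proof. exact: val_inj. Qed.

Lemma comul_subcoalg (d : subcoalg hD) :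
  comul (subcoalg_incl d) = tmap subcoalg_incl subcoalg_incl (comul d).
Proof. exact/esym/subcoalg_comulE. Qed.

Lemma counit_subcoalg (d : subcoalg hD) : counit (subcoalg_incl d) = counit d.
Proof. by []. Qed.

End SubcoalgTheory.

Section ProjectedAction.
Variables (K : fieldType) (H : weakHopfType K) (C : coalgType K).
Variable act : {linear (H ⊗ C)%type -> C}.
Variables (D : submodClosed C) (hD : subcoalgebra D).
Variable pi : {linear C -> C}.
Hypothesis pi_im : (range pi = [set c | c \in D])%classic.

Lemma proj_mem c : pi c \in D.
Proof. by have : range pi (pi c) by []; rewrite pi_im. Qed.

(* h ⊗ d |-> pi (h ▷ d), with values in D. *)
Definition projected_action :
    {linear (H ⊗ subcoalg hD)%type -> subcoalg hD} :=
  corestr proj_mem \o act \o tmap idfun (subcoalg_incl hD).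

Lemma projected_actionE h (d : subcoalg hD) :
  subcoalg_incl hD (projected_action (h ⊗ d)) =
  pi (act (h ⊗ subcoalg_incl hD d)).
Proof. exact: (congr1 (pi \o act) (tmap_tprod idfun (subcoalg_incl hD) h d)). Qed.

End ProjectedAction.

(* Main.v *)
(** The inclusion of D into C and its tensor square are injective and D carries
    the restricted comultiplication, so each axiom of the partial action may be
    tested in C. There the multiplicativity of the comultiplication becomes (i),
    because C is a module coalgebra, and the composition law becomes (ii); the
    unit axiom holds because [pi] fixes D. *)

Require Import Defs.
From HB Require Import structures.
From mathcomp Require Import all_boot all_algebra.
From mathcomp Require Import boolp classical_sets.

Set Implicit Arguments.
Unset Strict Implicit.

Import GRing.Theory.
Local Open Scope ring_scope.

(** The summands of (ii) and of the symmetry condition have this shape, a counit value times a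
    vector. A Sweedler sum can be transported along a linear map only once its summand is known to
    be bilinear. *)
Lemma bilin_scale (K : fieldType) (U V W : lmodType K)
    (p : U -> K) (f : V -> W) :
  scalar p -> linear f -> bilin (fun u v => p u *: f v).
Proof.
move=> hp hf; split=> [v a x y|u a x y] /=.
  by rewrite hp scalerDl scalerA.
by rewrite hf scalerDr !scalerA mulrC.
Qed.

Lemma bilin_flip (K : fieldType) (U V W : lmodType K) (b : U -> V -> W) :
  bilin b -> bilin (fun v u => b u v).
Proof. by move=> [b1 b2]; split. Qed.

Lemma tprod_linearr (K : fieldType) (U V W : lmodType K)
    (f : {linear (U ⊗ V)%type -> W}) u :
  linear (fun v => f (u ⊗ v)).
Proof. by move=> a x y; rewrite (tprod_bilin _ _).2 linearP. Qed.

(** Since the comultiplication of D restricts that of C, the Sweedler legs of an element of D may be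
    taken in D. *)
Lemma sw_comul_subcoalg (K : fieldType) (C : coalgType K) (D : submodClosed C)
    (hD : subcoalgebra D) (W : lmodType K) (b : C -> C -> W)
    (d : subcoalg hD) : bilin b ->
  tfold b (comul (subcoalg_incl hD d)) =
  \sw_(d1, d2 <- comul d) b (subcoalg_incl hD d1) (subcoalg_incl hD d2).
Proof. by move=> hb; rewrite comul_subcoalg tfold_tmap. Qed.

Lemma mem_subcoalg (K : fieldType) (C : coalgType K) (D : submodClosed C)
    (hD : subcoalgebra D) (P : C -> Prop) :
  (forall d : subcoalg hD, P (subcoalg_incl hD d)) <->
  (forall c, c \in D -> P c).
Proof.
split=> [h c cD|h d]; last exact/h/subcoalg_inclP.
exact: (h (Sub c cD : subspace D)).
Qed.

(** An element of D has the form [pi x], and [pi] is idempotent. *)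
Lemma proj_id (K : fieldType) (C : lmodType K) (D : submodClosed C)
    (pi : {linear C -> C}) (pi_proj : forall c, pi (pi c) = pi c)
    (pi_im : (range pi = [set c | c \in D])%classic) c :
  c \in D -> pi c = c.
Proof.
by move=> cD; have [x _ <-] : range pi c by rewrite pi_im.
Qed.

Section ProjectedActionTheory.
Context {K : fieldType} {H : weakHopfType K} {C : coalgType K}.
Context {act : {linear (H ⊗ C)%type -> C}}.
Context {D : submodClosed C} {hD : subcoalgebra D} { pi : {linear C -> C}}.
Context { pi_im : (range pi = [set c | c \in D])%classic}.

Local Notation incl := (subcoalg_incl hD).
Local Notation pact := (projected_action act hD pi_im).

Lemma pi_act_linear h : linear (fun c => pi (act (h ⊗ c))).
Proof. by move=> a x y; rewrite tprod_linearr linearP. Qed.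

Lemma counit_pi_act_scalar h : scalar (fun c => counit (pi (act (h ⊗ c)))).
Proof. by move=> a x y; rewrite pi_act_linear linearP. Qed.

(** By the comultiplication axiom of [act], the tensor square of the inclusion sends the right-hand
    sum to the left side of (i); this tensor square is injective. *)
Lemma projected_action_comul (act_mc : module_coalgebra act) h
    (d : subcoalg hD) :
  comul (pact (h ⊗ d)) =
    \sw_(h1, h2 <- comul h) \sw_(d1, d2 <- comul d)
      (pact (h1 ⊗ d1) ⊗ pact (h2 ⊗ d2)) <->
  tmap pi pi (comul (act (h ⊗ incl d))) = comul (pi (act (h ⊗ incl d))).
Proof.
have -> : tmap pi pi (comul (act (h ⊗ incl d))) =
    tmap incl incl (\sw_(h1, h2 <- comul h) \sw_(d1, d2 <- comul d)
      (pact (h1 ⊗ d1) ⊗ pact (h2 ⊗ d2))).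
  rewrite (mc_comul act_mc) !linear_tfold.
  congr tfold; apply/funext => h1; apply/funext => h2.
  rewrite !linear_tfold sw_comul_subcoalg.
    congr tfold; apply/funext => d1; apply/funext => d2.
    by rewrite [LHS]tmap_tprod [RHS]tmap_tprod !projected_actionE.
  (* Bilinearity in the two legs of [incl d], required for moving the inner sum from C to D. *)
  by split=> [v a x y|u a x y];
    rewrite tprod_linearr ((tprod_bilin _ _).1, (tprod_bilin _ _).2) linearP.
rewrite -(projected_actionE act pi_im) comul_subcoalg.
by split=> [->//|/tmap_incl_inj].
Qed.

(** The second equation is the image of the first under the injective inclusion of D. *)
Lemma projected_action_act h k (d : subcoalg hD) :
  pact (h ⊗ pact (k ⊗ d)) =
    \sw_(k1, k2 <- comul k) \sw_(d1, d2 <- comul d)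
      (counit (pact (k2 ⊗ d2)) *: pact ((h ∙ k1) ⊗ d1)) <->
  pi (act (h ⊗ pi (act (k ⊗ incl d)))) =
    \sw_(k1, k2 <- comul k) \sw_(d1, d2 <- comul (incl d))
      (counit (pi (act (k2 ⊗ d2))) *: pi (act ((h ∙ k1) ⊗ d1))).
Proof.
rewrite -!(projected_actionE act pi_im).
set s := (X in _ = X <-> _); set t := (X in _ <-> _ = X).
have -> : t = incl s; last by split=> [->//|/subcoalg_incl_inj].
rewrite !linear_tfold; congr tfold; apply/funext => k1; apply/funext => k2.
rewrite !linear_tfold sw_comul_subcoalg.
  congr tfold; apply/funext => d1; apply/funext => d2.
  (* The scalars agree by computation, as the counit of D is that of C composed with the
     inclusion. *)
  by rewrite [RHS]linearZ -!(projected_actionE act pi_im).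
(* The scalar depends on the second leg, hence the exchange of arguments. *)
exact/bilin_flip/bilin_scale/pi_act_linear/counit_pi_act_scalar.
Qed.

(** Same transport along the inclusion, with the counit now on the first legs. *)
Lemma projected_action_sym h k (d : subcoalg hD) :
  pact (h ⊗ pact (k ⊗ d)) =
    \sw_(k1, k2 <- comul k) \sw_(d1, d2 <- comul d)
      (counit (pact (k1 ⊗ d1)) *: pact ((h ∙ k2) ⊗ d2)) <->
  pi (act (h ⊗ pi (act (k ⊗ incl d)))) =
    \sw_(k1, k2 <- comul k) \sw_(d1, d2 <- comul (incl d))
      (counit (pi (act (k1 ⊗ d1))) *: pi (act ((h ∙ k2) ⊗ d2))).
Proof.
rewrite -!(projected_actionE act pi_im).
set s := (X in _ = X <-> _); set t := (X in _ <-> _ = X).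
have -> : t = incl s; last by split=> [->//|/subcoalg_incl_inj].
rewrite !linear_tfold; congr tfold; apply/funext => k1; apply/funext => k2.
rewrite !linear_tfold sw_comul_subcoalg.
  congr tfold; apply/funext => d1; apply/funext => d2.
  by rewrite [RHS]linearZ -!(projected_actionE act pi_im).
exact/bilin_scale/pi_act_linear/counit_pi_act_scalar.
Qed.

End ProjectedActionTheory.

Theorem proposition3p18 (K : fieldType) (H : weakHopfType K) (C : coalgType K)
    (act : {linear (H ⊗ C)%type -> C}) (act_mc : module_coalgebra act)
    (D : submodClosed C) (hD : subcoalgebra D)
    (pi : {linear C -> C}) (pi_proj : forall c, pi (pi c) = pi c)
    (pi_im : (range pi = [set c | c \in D])%classic) :
  (partial_module_coalgebra (projected_action act hD pi_im) <->
    (forall (h : H) (d : C), d \in D ->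
       tmap pi pi (comul (act (h ⊗ d))) = comul (pi (act (h ⊗ d)))) /\
    (forall (h k : H) (d : C), d \in D ->
       pi (act (h ⊗ pi (act (k ⊗ d)))) =
       \sw_(k1, k2 <- comul k) \sw_(d1, d2 <- comul d)
         (counit (pi (act (k2 ⊗ d2))) *: pi (act ((h ∙ k1) ⊗ d1)))))
  /\
  (partial_module_coalgebra (projected_action act hD pi_im) ->
    (symmetric_action (projected_action act hD pi_im) <->
     forall (h k : H) (d : C), d \in D ->
       pi (act (h ⊗ pi (act (k ⊗ d)))) =
       \sw_(k1, k2 <- comul k) \sw_(d1, d2 <- comul d)
         (counit (pi (act (k1 ⊗ d1))) *: pi (act ((h ∙ k2) ⊗ d2))))).
Proof.
split; last first.
  move=> _; split=> [sym h k|sym h k d].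
    by apply/(mem_subcoalg hD) => d; apply/projected_action_sym/sym.
  by apply/projected_action_sym; apply: sym; exact: subcoalg_inclP.
split=> [[_ pcomul pact]|[picomul piact]].
  split=> [h|h k]; apply/(mem_subcoalg hD) => d.
    exact/(projected_action_comul act_mc)/pcomul.
  exact/projected_action_act/pact.
split=> [d|h d|h k d].
(* In C the unit axiom reads [pi d = d] for d in D. *)
- apply: subcoalg_incl_inj; rewrite projected_actionE (mc_unit act_mc).
  by rewrite (proj_id pi_proj pi_im) // subcoalg_inclP.
- by apply/(projected_action_comul act_mc)/picomul/subcoalg_inclP.
- by apply/projected_action_act/piact/subcoalg_inclP.
Qed.
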